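(* If $H$ is a tree and a shortest path graph, then $H$ is a path.
   Context: Graphs are finite and simple. For a graph $G$ with distinct vertices $a,b$, a shortest $a,b$-path is a path between $a$ and $b$ of length $d_G(a,b)$. The shortest path graph $S(G,a,b)$ is the graph whose vertices are the shortest $a,b$-paths in $G$, two of them being adjacent if and only if the corresponding paths differ in exactly one vertex. A graph $H$ is called a shortest path graph if there exist a graph $G$ and distinct $a,b\in V(G)$ with $S(G,a,b)\cong H$. A single vertex counts as a (trivial) path. *)

(* Defs.v *)
From mathcomp Require Import all_boot.

Set Implicit Arguments.
Unset Strict Implicit.
Unset Printing Implicit Defensive.

Record sgraph := SGraph {
  vertex :> finType;
  adj : rel vertex;
  adj_sym : symmetric adj;
  adj_irrefl : irreflexive adj
}.

Definition isomorphic (G H : sgraph) : Prop :=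
  exists2 f : G -> H, bijective f & forall x y, adj (f x) (f y) = adj x y.

(* An a,b-path is written without its initial vertex, as in [path]: the
   sequence of its vertices is [a :: p], and its length is [size p]. *)
Definition is_path (G : sgraph) (a b : G) (p : seq G) : bool :=
  [&& path (@adj G) a p, last a p == b & uniq (a :: p)].

(* The least length of an a,b-path; since paths have no repeated vertex only
   lengths below #|G| matter, and the value is #|G| when there is no a,b-path. *)
Definition dist (G : sgraph) (a b : G) : nat :=
  find (fun n => [exists p : n.-tuple G, is_path a b p]) (iota 0 #|G|).

Lemma size_is_path (G : sgraph) (a b : G) p : is_path a b p -> size p < #|G|.
Proof.
by case/and3P => _ _ /card_uniqP /= <-; exact: max_card.
Qed.

Lemma dist_le (G : sgraph) (a b : G) p : is_path a b p -> dist a b <= size p.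
Proof.
move=> pP; rewrite leqNgt; apply/negP => /(before_find 0).
rewrite nth_iota ?(size_is_path pP) // add0n => /existsP; apply.
by exists (in_tuple p).
Qed.

Lemma dist_attained (G : sgraph) (a b : G) p :
  is_path a b p -> exists2 q, is_path a b q & size q = dist a b.
Proof.
move=> pP; set P := fun n => [exists q : n.-tuple G, is_path a b q].
have hP : has P (iota 0 #|G|).
  apply/hasP; exists (size p); first by rewrite mem_iota (size_is_path pP).
  by apply/existsP; exists (in_tuple p).
have := nth_find 0 hP; rewrite nth_iota; last first.
  by move: hP; rewrite has_find size_iota.
by rewrite add0n => /existsP [q qP]; exists q => //; rewrite size_tuple.
Qed.

Definition shortest_path (G : sgraph) (a b : G) : finType :=
  {p : (dist a b).-tuple G | is_path a b p}.

(* Both paths start at a and have the same length, and a vertex of a shortest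
   a,b-path sits at the position given by its distance from a, so the paths can
   be compared position by position. *)
Definition differ_in_one (G : sgraph) (a b : G) : rel (shortest_path a b) :=
  fun p q => #|[set i | tnth (val p) i != tnth (val q) i]| == 1.

Lemma differ_in_one_sym (G : sgraph) (a b : G) :
  symmetric (@differ_in_one G a b).
Proof.
move=> p q; rewrite /differ_in_one; congr (#|pred_of_set _| == 1).
by apply/setP => i; rewrite !inE eq_sym.
Qed.

Lemma differ_in_one_irrefl (G : sgraph) (a b : G) :
  irreflexive (@differ_in_one G a b).
Proof.
move=> p; rewrite /differ_in_one (_ : [set i | _] = set0) ?cards0 //.
by apply/setP => i; rewrite !inE eqxx.
Qed.

Definition S_graph (G : sgraph) (a b : G) : sgraph :=
  SGraph (@differ_in_one_sym G a b) (@differ_in_one_irrefl G a b).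

Definition is_shortest_path_graph (H : sgraph) : Prop :=
  exists (G : sgraph) (a b : G), a <> b /\ isomorphic (S_graph a b) H.

Definition connected (G : sgraph) : Prop :=
  0 < #|G| /\ forall x y : G, connect (@adj G) x y.

(* [ucycle] also accepts the empty sequence and [:: x; y] with x, y adjacent,
   which are not cycles of a simple graph. *)
Definition acyclic (G : sgraph) : Prop :=
  forall c : seq G, ucycle (@adj G) c -> size c < 3.

Definition is_tree (G : sgraph) : Prop := connected G /\ acyclic G.

Definition consecutive (n : nat) : rel 'I_n :=
  fun i j => (i.+1 == j) || (j.+1 == i).

Lemma consecutive_sym n : symmetric (@consecutive n).
Proof. by move=> i j; rewrite /consecutive orbC. Qed.

Lemma consecutive_irrefl n : irreflexive (@consecutive n).
Proof. by move=> i; rewrite /consecutive orbb gtn_eqF. Qed.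

Definition path_graph (n : nat) : sgraph :=
  SGraph (@consecutive_sym n) (@consecutive_irrefl n).

Definition is_path_graph (H : sgraph) : Prop :=
  exists n, isomorphic H (path_graph n.+1).

(* Main.v *)
Require Import Defs.
From mathcomp Require Import all_boot.
From mathcomp Require Import zify.

(** Neighbours of a shortest path [U] are obtained by replacing one vertex of
    [U].  Two neighbours replacing the same vertex are adjacent and form a
    triangle with [U]; two neighbours replacing vertices at non-consecutive
    positions have a second common neighbour, obtained by making both
    replacements, and lie on a 4-cycle.  In an acyclic shortest path graph the
    positions of the neighbours of [U] are hence pairwise consecutive, so there
    are at most two of them.  A tree of maximum degree at most two is a path. *)

Set Implicit Arguments.
Unset Strict Implicit.
Unset Printing Implicit Defensive.

(** * Transfer along isomorphisms, and excluded short cycles *)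

Definition degree_le2 (G : sgraph) : Prop :=
  forall (u : G) (s : seq G), uniq s -> all (adj u) s -> size s < 3.

Lemma isomorphic_sym (G H : sgraph) : isomorphic G H -> isomorphic H G.
Proof.
case=> f [g fK gK] fadj; exists g; first by exists f.
by move=> x y; rewrite -fadj !gK.
Qed.

Lemma degree_le2_iso (G H : sgraph) :
  isomorphic G H -> degree_le2 G -> degree_le2 H.
Proof.
move=> /isomorphic_sym[g /bij_inj g_inj gadj] degG u s s_uniq s_adj.
rewrite -(size_map g); apply: (degG (g u)); first by rewrite map_inj_uniq.
by rewrite all_map (eq_all (gadj u)).
Qed.

Lemma acyclic_iso (G H : sgraph) : isomorphic G H -> acyclic H -> acyclic G.
Proof.
move=> [f /bij_inj f_inj fadj] acH c /andP[c_cycle c_uniq].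
rewrite -(size_map f); apply: acH; rewrite /ucycle map_inj_uniq // c_uniq andbT.
by apply: homo_cycle c_cycle => x y; rewrite fadj.
Qed.

Lemma adj_neq (G : sgraph) (x y : G) : adj x y -> x != y.
Proof. by apply: contraTneq => ->; rewrite adj_irrefl. Qed.

Lemma acyclic_no_triangle (G : sgraph) (x y z : G) :
  acyclic G -> adj x y -> adj x z -> adj y z -> False.
Proof.
move=> acG xy xz yz; suff /acG : ucycle (@adj G) [:: x; y; z] by [].
by rewrite /ucycle /= !inE negb_or xy yz (adj_sym z) xz !adj_neq.
Qed.

Lemma acyclic_no_square (G : sgraph) (x y z w : G) :
  acyclic G -> adj x y -> adj x z -> adj y w -> adj z w ->
  y != z -> w = x.
Proof.
move=> acG xy xz yw zw yz; apply/eqP/contraT => wx.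
suff /acG : ucycle (@adj G) [:: x; y; w; z] by [].
rewrite /ucycle /= !inE !negb_or xy yw (adj_sym w) zw (adj_sym z) xz.
by rewrite (eq_sym x w) wx yz (eq_sym w z) !adj_neq.
Qed.

(** * Trees of maximum degree at most two *)

Section PathOfTree.
Variable G : sgraph.
Local Notation e := (@adj G).

Lemma exists_longest_path :
  0 < #|G| -> exists s : seq G,
    [/\ s != [::], uniq s, sorted e s
      & forall t, uniq t -> sorted e t -> size t <= size s].
Proof.
move=> /card_gt0P[x _].
pose P n := [exists t : n.-tuple G, uniq t && sorted e t].
have PP (t : seq G) : uniq t -> sorted e t -> P (size t).
  by move=> tu ts; apply/existsP; exists (in_tuple t); rewrite tu.
(* The one-vertex path starts the search for a maximum and makes the longest path nonempty. *)
have P1 : P 1 by apply: (PP [:: x]).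
have Pbound n : P n -> n <= #|G|.
  by case/existsP=> t /andP[/card_uniqP tu _]; rewrite -(size_tuple t) -tu max_card.
case: (ex_maxnP (ex_intro _ 1 P1) Pbound) => n /existsP[t /andP[tu ts]] nmax.
exists t; split=> // [|t' t'u t's]; last by rewrite size_tuple nmax ?PP.
by rewrite -size_eq0 size_tuple -lt0n nmax.
Qed.

(** A neighbour outside [s] of an end of [s] would extend it, and one of an inner vertex would be
    its third neighbour. *)
Lemma longest_path_closed (s : seq G) :
  degree_le2 G -> uniq s -> sorted e s ->
  (forall t, uniq t -> sorted e t -> size t <= size s) ->
  forall u v, e u v -> u \in s -> v \in s.
Proof.
move=> deg2 + + + u v euv us; case/splitPr: us => s1 s2 su ss smax.
case: (boolP (v \in _)) => // vs; exfalso.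
have evu : e v u by rewrite adj_sym.
case/lastP: s1 su ss smax vs => [|s1 w1] su ss smax vs.
  have := smax (v :: u :: s2); rewrite /= ltnn => H.
  by apply: notF; apply: H; [move: su vs => /= -> -> | rewrite evu].
case: s2 su ss smax vs => [|w2 s2] su ss smax vs.
  have := smax (rcons (rcons (rcons s1 w1) u) v).
  rewrite cats1 !size_rcons ltnn => H; apply: notF; apply: H.
    by rewrite rcons_uniq -cats1 vs.
  move: ss; rewrite cats1; case: (s1) => [|y s1'] /=; first by rewrite !andbT => ->.
  by rewrite !rcons_path !last_rcons euv andbT.
have [ew1 ew2] : e u w1 /\ e u w2.
  move: ss; rewrite cat_rcons; case: (s1) => [|y s1'] /=.
    by rewrite (adj_sym u w1) => /and3P[-> ->].
  by rewrite cat_path /= (adj_sym u w1) => /and5P[_ _ -> ->].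
suff : size [:: w1; w2; v] < 3 by [].
apply: (deg2 u); last by rewrite /= ew1 ew2 euv.
move: su vs; rewrite cat_uniq mem_cat negb_or mem_rcons !inE !negb_or rcons_uniq.
move=> /and3P[_ + _] /andP[/andP[vw1 _] /and3P[_ vw2 _]] /=.
rewrite !mem_rcons !inE !negb_or => /and3P[_ /andP[w2w1 _] _].
by rewrite (eq_sym w1 w2) w2w1 (eq_sym w1 v) (eq_sym w2 v) vw1 vw2.
Qed.

(** The segment of [s] from [i] to [j], closed by the chord, is a cycle on [j - i + 1] vertices. *)
Lemma acyclic_path_chord (x0 : G) (s : seq G) (i j : nat) :
  acyclic G -> uniq s -> sorted e s -> i < j < size s ->
  e (nth x0 s i) (nth x0 s j) -> j = i.+1.
Proof.
move=> acG su ss /andP[ij js] eij.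
pose c := drop i (take j.+1 s).
have sc : size c = j.+1 - i by rewrite size_drop size_take_min (minn_idPl js).
have nc k : k <= j - i -> nth x0 c k = nth x0 s (i + k).
  by move=> kj; rewrite nth_drop nth_take //; lia.
have : size c < 3; last by rewrite sc; lia.
apply: acG; rewrite /ucycle drop_uniq ?take_uniq // andbT.
have : sorted e c by rewrite drop_sorted ?take_sorted.
case: c sc nc => [|y c] /= sc nc; first by lia.
rewrite rcons_path => -> /=; rewrite -[last y c]/(last x0 (y :: c)) -nth_last.
rewrite nc /=; last by lia.
have := nc 0 isT; rewrite addn0 /= => ->.
by rewrite (_ : i + size c = j) 1?adj_sym //; lia.
Qed.

(** By connectedness a longest path contains every vertex, and it has no chords, so the index along
    it is an isomorphism. *)
Lemma tree_degree_le2_is_path : is_tree G -> degree_le2 G -> is_path_graph G.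
Proof.
case=> [[G_gt0 Gconn] acG] deg2.
have [s [s_neq0 su ss smax]] := exists_longest_path G_gt0.
have scl := longest_path_closed deg2 su ss smax.
case: s s_neq0 su ss scl {smax} => // x s _ su ss scl.
have in_s y : y \in x :: s.
  have cl := intro_closed (sym_connect_sym (@adj_sym G)) scl.
  by rewrite -(closed_connect cl (Gconn x y)) mem_head.
have idx y : index y (x :: s) < (size s).+1 by rewrite -/(size (x :: s)) index_mem.
pose f y : path_graph (size s).+1 := Ordinal (idx y).
exists (size s), f.
  exists (fun i : 'I__ => nth x (x :: s) i) => [y|i]; first by rewrite /f /= nth_index.
  by apply: val_inj; apply: (@index_uniq _ x i (x :: s) (ltn_ord i) su).
move=> y z; rewrite /= /consecutive.
rewrite -[in RHS](nth_index x (in_s y)) -[in RHS](nth_index x (in_s z)).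
change (((f y).+1 == f z :> nat) || ((f z).+1 == f y :> nat) =
  e (nth x (x :: s) (f y)) (nth x (x :: s) (f z))).
move: (f y) (f z) => [i /= im] [j /= jm] {y z}.
have step k : k < size s -> e (nth x (x :: s) k) (nth x (x :: s) k.+1).
  by move=> ks; apply: (pathP x ss).
apply/orP/idP => [[/eqP ij|/eqP ji]|eij].
- by rewrite -ij step //; lia.
- by rewrite adj_sym -ji step //; lia.
- case: (ltngtP i j) => [ij|ji|ij].
  + by left; rewrite (@acyclic_path_chord x (x :: s) i j) ?ij.
  + by right; rewrite (@acyclic_path_chord x (x :: s) j i) ?ji // adj_sym.
  + by rewrite ij adj_irrefl in eij.
Qed.

End PathOfTree.

(** * Replacing vertices of a shortest path *)

Section ShortestPaths.
Variables (G : sgraph) (a b : G).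
Local Notation e := (@adj G).
Local Notation S := (S_graph a b).
Implicit Types U V W : S.

(** Shortening the walk to a path cannot reduce its length below the distance, so the path has as
    many vertices as the walk, all taken from it; hence the walk repeats none. *)
Lemma shortest_walk_is_path (p : seq G) :
  path e a p -> last a p = b -> size p = dist a b -> is_path a b p.
Proof.
move=> ep lp sp; rewrite /is_path ep lp eqxx /=.
case: (shortenP ep) lp => p' ep' up' sub lp'.
have : dist a b <= size p' by apply: dist_le; rewrite /is_path ep' lp' eqxx.
rewrite -sp => sz; apply: (@leq_size_uniq _ (a :: p') (a :: p) up') => //.
by move=> x; rewrite !inE => /orP[->//|/sub ->]; rewrite orbT.
Qed.

Definition replaces U V (i : 'I_(dist a b)) : Prop :=
  forall j, (tnth (val U) j != tnth (val V) j) = (j == i).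

Lemma adj_replacesP U V : reflect (exists i, replaces U V i) (adj U V).
Proof.
apply: (iffP cards1P) => -[i Ui]; exists i.
  by move=> j; move/setP/(_ j): Ui; rewrite !inE.
by apply/setP => j; rewrite !inE Ui.
Qed.

Lemma replaces_neq U V i j : replaces U V i -> j != i ->
  tnth (val V) j = tnth (val U) j.
Proof. by move=> r /negbTE ji; apply/esym/eqP; apply: negbFE; rewrite r. Qed.

(** Off [i] both paths agree with [U], so being distinct they differ exactly at [i]. *)
Lemma replaces_same_adj U V1 V2 i :
  replaces U V1 i -> replaces U V2 i -> V1 != V2 -> adj V1 V2.
Proof.
move=> r1 r2 V12; apply/adj_replacesP; exists i => j.
case: (eqVneq j i) => [->|ji]; last first.
  by rewrite (replaces_neq r1) // (replaces_neq r2) // eqxx.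
apply: contraNneq V12 => eqi; apply/eqP/val_inj/eq_from_tnth => k.
case: (eqVneq k i) => [->//|ki].
by rewrite (replaces_neq r1) // (replaces_neq r2).
Qed.

Lemma common_neighbour U V1 V2 i1 i2 :
  replaces U V1 i1 -> replaces U V2 i2 -> i1 != i2 ->
  ~~ consecutive i1 i2 -> exists W, [/\ W != U, adj V1 W & adj V2 W].
Proof.
move=> r1 r2 i12; rewrite /consecutive negb_or => /andP[ni12 ni21].
have nat_i12 : i1 != i2 :> nat by [].
(* Both replacements at once: [V2] already has its own at [i2] and the vertices of [U] elsewhere. *)
pose w := [tuple if i == i1 then tnth (val V1) i else tnth (val V2) i
  | i < dist a b].
have w1 j : j != i2 -> tnth w j = tnth (val V1) j.
  move=> ji2; rewrite tnth_mktuple; case: (eqVneq j i1) => // ji1.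
  by rewrite (replaces_neq r1) // (replaces_neq r2).
have w2 j : j != i1 -> tnth w j = tnth (val V2) j.
  by move=> /negbTE ji1; rewrite tnth_mktuple ji1.
pose c (t : seq G) k := nth a (a :: t) k.
have cE (t t' : (dist a b).-tuple G) (i : 'I_(dist a b)) k :
    (forall j, j != i -> tnth t j = tnth t' j) -> k <= dist a b -> k != i.+1 ->
    c t k = c t' k.
  case: k => // k tt' kd; rewrite /c /= eqSS => ki.
  by have := tt' (Ordinal kd) ki; rewrite !(tnth_nth a).
have c1 k := cE _ _ i2 k w1.
have c2 k := cE _ _ i1 k w2.
have stepV (V : S) k : k < dist a b -> e (c (val V) k) (c (val V) k.+1).
  have /and3P[/(pathP a) + _ _] := valP V.
  by rewrite size_tuple => /(_ k) sV kd; apply: sV.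
have lastV (V : S) : c (val V) (dist a b) = b.
  have /and3P[_ /eqP + _] := valP V.
  by rewrite (last_nth a) size_tuple.
have wP : is_path a b w.
  apply: shortest_walk_is_path; last by rewrite size_tuple.
    apply/(pathP a) => k; rewrite size_tuple => kd.
    change (e (c w k) (c w k.+1)).
    (* [c] is shifted by one: [c w i.+1] is [tnth w i].  As the replaced
       positions are not consecutive, no edge of [w] meets both of them, so
       each edge is an edge of [V1] or of [V2]. *)
    case: (boolP ((k == i1) || (k == i1.+1))) => [ki|ki].
      by rewrite !c1 ?stepV //; lia.
    by rewrite !c2 ?stepV //; lia.
  rewrite (last_nth a) size_tuple -/(c w (dist a b)).
  (* The end of [w] is compared with [V2], unless [i1] is the last position; then [i2] is not, and
     [V1] serves. *)
  case: (eqVneq (dist a b) i1.+1) => di; last by rewrite c2.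
  by rewrite c1 //; lia.
pose W : S := exist _ w wP; exists W; split.
(* At [i1] the path [W] has the vertex of [V1], which is not that of [U]. *)
- apply: contraTneq (eqxx i1) => WU; rewrite -r1 -WU /= w1 //.
  by rewrite eqxx.
- apply/adj_replacesP; exists i2 => j /=.
  case: (eqVneq j i2) => [->|ji]; last by rewrite w1 // eqxx.
  by rewrite w2 1?eq_sym // (replaces_neq r1) 1?eq_sym // r2 eqxx.
- apply/adj_replacesP; exists i1 => j /=.
  case: (eqVneq j i1) => [->|ji]; last by rewrite w2 // eqxx.
  by rewrite w1 // (replaces_neq r2) // r1 eqxx.
Qed.

Lemma acyclic_replaces_consecutive U V1 V2 i1 i2 :
  acyclic S -> replaces U V1 i1 -> replaces U V2 i2 -> V1 != V2 ->
  consecutive i1 i2.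
Proof.
move=> acS r1 r2 V12.
have e1 : adj U V1 by apply/adj_replacesP; exists i1.
have e2 : adj U V2 by apply/adj_replacesP; exists i2.
case: (eqVneq i1 i2) => [i12|i12].
  rewrite -i12 in r2; have := replaces_same_adj r1 r2 V12.
  by move/(acyclic_no_triangle acS e1 e2).
(* Otherwise [U], [V1], [W], [V2] would form a 4-cycle. *)
apply: contraT => /(common_neighbour r1 r2 i12)[W [WU e1W e2W]].
by rewrite (acyclic_no_square acS e1 e2 e1W e2W V12) eqxx in WU.
Qed.

Lemma acyclic_S_graph_degree_le2 : acyclic S -> degree_le2 S.
Proof.
move=> acS U [|V1 [|V2 [|V3 s]]] //.
rewrite [uniq _]/= !inE !negb_or => /andP[/and3P[n12 n13 _] /andP[/andP[n23 _] _]].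
move=> /and4P[/adj_replacesP[i1 r1] /adj_replacesP[i2 r2] /adj_replacesP[i3 r3] _].
have := acyclic_replaces_consecutive acS r1 r2 n12.
have := acyclic_replaces_consecutive acS r1 r3 n13.
have := acyclic_replaces_consecutive acS r2 r3 n23.
(* Consecutive positions have opposite parities, so three positions cannot be pairwise
   consecutive. *)
by rewrite /consecutive; lia.
Qed.

End ShortestPaths.

Theorem mainTheorem11 (H : sgraph) (hT : is_tree H)
  (hS : is_shortest_path_graph H) : is_path_graph H.
Proof.
have [G [a [b [_ SH]]]] := hS; have [_ acH] := hT.
apply: tree_degree_le2_is_path hT (degree_le2_iso SH _).
exact: acyclic_S_graph_degree_le2 (acyclic_iso SH acH).
Qed.
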